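(* If $\overline{\alpha}_R$ is residuated in the $k$-th argument place, then $\beta^k_{R/}$ is its residual and $ \beta^k_{R/}(\vec{E}[G]_k)$ is a Galois set, i.e. the union in the definition $\beta^k_{R/}(\vec{E}[G]_k)=\bigcup\{F\in\mathcal{G}(Z_{i_k})\mid\alpha_R(\vec{E}[F]_k)\subseteq G\}$ is actually a join in $\mathcal{G}(Z_{i_k})$.
   Context: Let $(X,I,Y)$ be a polarity: nonempty sets $Z_1=X$, $Z_\partial=Y$ and a relation $I\subseteq X\times Y$, inducing the Galois connection $U^{\perp}=\{y\in Y\mid \forall x\in U\; xIy\}$, ${}^{\perp}V=\{x\in X\mid \forall y\in V\; xIy\}$. Galois sets are the stable sets $A={}^{\perp}(A^{\perp})\subseteq X$ and co-stable sets $B=({}^{\perp}B)^{\perp}\subseteq Y$, forming complete lattices $\mathcal{G}(Z_1)=\mathcal G(X)$, $\mathcal{G}(Z_\partial)=\mathcal G(Y)$; $W'$ denotes $W^{\perp}$ or ${}^{\perp}W$ according to whether $W\subseteq X$ or $W\subseteq Y$. Let $R\subseteq Z_{i_{n+1}}\times\prod_{j=1}^n Z_{i_j}$ ($i_j\in\{1,\partial\}$) be a relation with image operator $\alpha_R(\vec{W})=\bigcup_{\vec{w}\in\vec{W}}R\vec{w}$, and $\overline{\alpha}_R(\vec{F})=(\alpha_R(\vec{F}))''$ for Galois sets $F_j\in\mathcal{G}(Z_{i_j})$. $\vec{E}[F]_k$ is the tuple $\vec E$ with $k$-th component replaced by $F$. For Galois sets $E_j$ and $G\in\mathcal G(Z_{i_{n+1}})$,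 $\beta^k_{R/}(\vec{E}[G]_k)=\bigcup\{F\in\mathcal{G}(Z_{i_k})\mid\alpha_R(\vec{E}[F]_k)\subseteq G\}$ (the restriction to Galois sets of the $k$-residual of $\alpha_R$). *)

(* Defs.v *)
From mathcomp Require Import all_boot.
From mathcomp Require Import boolp classical_sets.

Set Implicit Arguments.
Unset Strict Implicit.
Unset Printing Implicit Defensive.

Local Open Scope classical_set_scope.

Record polarity := Polarity {
  polX : Type;
  polY : Type;
  polI : polX -> polY -> Prop;
  polX_nonempty : inhabited polX;
  polY_nonempty : inhabited polY }.

Inductive psort := One | Partial.

Definition Z (P : polarity) (s : psort) : Type :=
  match s with One => polX P | Partial => polY P end.

Definition rperp (P : polarity) (U : set (polX P)) : set (polY P) :=
  [set y | forall x, U x -> polI x y].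

Definition lperp (P : polarity) (V : set (polY P)) : set (polX P) :=
  [set x | forall y, V y -> polI x y].

(* W'' : the closure on subsets of X or on subsets of Y, by sort *)
Definition dprime (P : polarity) (s : psort) : set (Z P s) -> set (Z P s) :=
  match s with
  | One => fun U => lperp (rperp U)
  | Partial => fun V => rperp (lperp V)
  end.

Definition is_galois (P : polarity) (s : psort) (W : set (Z P s)) : Prop :=
  W = dprime W.

Record galois (P : polarity) (s : psort) := Galois {
  gal_set :> set (Z P s);
  gal_setP : is_galois gal_set }.

Lemma dprime_is_galois (P : polarity) (s : psort) (W : set (Z P s)) :
  is_galois (dprime W).
Proof.
case: s W => W; apply/seteqP; split=> z /= zW.
- by move=> y; apply.
- by move=> y yW; apply: zW => x; apply.
- by move=> x; apply.
- by move=> x xW; apply: zW => y; apply.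
Qed.

(* Least upper bound in the lattice of Galois sets ordered by inclusion *)
Definition is_galois_join (P : polarity) (s : psort) (S : set (galois P s))
    (B : set (Z P s)) : Prop :=
  [/\ is_galois B,
      forall F : galois P s, S F -> F `<=` B &
      forall H : galois P s,
        (forall F : galois P s, S F -> F `<=` H) -> B `<=` H].

Section Operators.

Variables (P : polarity) (n : nat) (i : 'I_n -> psort) (o : psort).

Definition image_op (R : Z P o -> (forall j, Z P (i j)) -> Prop)
    (W : forall j, set (Z P (i j))) : set (Z P o) :=
  \bigcup_(w in [set w : forall j, Z P (i j) | forall j, W j (w j)])
    [set z | R z w].

Definition image_op_closed (R : Z P o -> (forall j, Z P (i j)) -> Prop)
    (F : forall j, galois P (i j)) : galois P o :=
  Galois (dprime_is_galois (image_op R (fun j => F j))).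

(* [dfwith E F] is the tuple E[F]_k. As G need not have the sort of the k-th
   argument, a residual at E[G]_k is written [g E G]; the equivalence itself
   forces a Galois-set-valued g to be independent of [E k]. *)
Definition is_residual (f : (forall j, galois P (i j)) -> galois P o) (k : 'I_n)
    (g : (forall j, galois P (i j)) -> galois P o -> set (Z P (i k))) : Prop :=
  forall (E : forall j, galois P (i j)) (F : galois P (i k)) (G : galois P o),
    f (dfwith E F) `<=` G <-> F `<=` g E G.

Definition residuated_at (f : (forall j, galois P (i j)) -> galois P o)
    (k : 'I_n) : Prop :=
  exists g : (forall j, galois P (i j)) -> galois P o -> galois P (i k),
    is_residual f (fun E G => g E G).

Definition residual_family (R : Z P o -> (forall j, Z P (i j)) -> Prop)
    (k : 'I_n) (E : forall j, galois P (i j)) (G : galois P o) :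
    set (galois P (i k)) :=
  [set F | image_op R (fun j => dfwith E F j) `<=` G].

Definition beta (R : Z P o -> (forall j, Z P (i j)) -> Prop)
    (k : 'I_n) (E : forall j, galois P (i j)) (G : galois P o) :
    set (Z P (i k)) :=
  \bigcup_(F in residual_family R E G) F.

End Operators.

Arguments residual_family {P n i o} R k E G.
Arguments beta {P n i o} R k E G.

(* Main.v *)
(** The key point: when the closed image operator has a Galois-set-valued
    residual [g], the family [residual_family R k E G] is exactly the principal
    down-set of [g E G], so that its union is [g E G] itself. *)
Require Import Defs.
From mathcomp Require Import all_boot.
From mathcomp Require Import boolp classical_sets.

Set Implicit Arguments.
Unset Strict Implicit.

Local Open Scope classical_set_scope.

Lemma sub_dprime (P : polarity) (s : psort) (W : set (Z P s)) : W `<=` dprime W.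
Proof. by case: s W => W z Wz w; apply. Qed.

Lemma dprimeS (P : polarity) (s : psort) (U W : set (Z P s)) :
  U `<=` W -> dprime U `<=` dprime W.
Proof.
by case: s U W => U W UW z zU w Ww; apply: zU => u Uu; apply: Ww; apply: UW.
Qed.

(** Since [G] equals its own closure, testing inclusion in [G] cannot tell [W] from [dprime W]. This
    lets [image_op] replace [image_op_closed] below a Galois set. *)
Lemma dprime_sub_galois (P : polarity) (s : psort) (W : set (Z P s))
    (G : galois P s) : dprime W `<=` G <-> W `<=` G.
Proof.
split=> [WG z Wz|WG]; first exact: WG (sub_dprime Wz).
by rewrite (gal_setP G); apply: dprimeS.
Qed.

Lemma beta_residual (P : polarity) (n : nat) (i : 'I_n -> psort) (o : psort)
    (R : Z P o -> (forall j : 'I_n, Z P (i j)) -> Prop) (k : 'I_n)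
    (g : (forall j, galois P (i j)) -> galois P o -> galois P (i k))
    (E : forall j, galois P (i j)) (G : galois P o) :
  is_residual (image_op_closed R) (fun E G => g E G) ->
  beta R k E G = g E G.
Proof.
move=> gP.
have famP F : residual_family R k E G F <-> F `<=` g E G.
  by rewrite -gP; apply: iff_sym; apply: dprime_sub_galois.
apply/seteqP; split=> [z [F /famP]|z gz]; first exact.
(* Being a Galois set, [g E G] is itself a member of the family, namely its largest one. *)
by exists (g E G) => //; apply/famP.
Qed.

Theorem theorem2p13 (P : polarity) (n : nat) (i : 'I_n -> psort) (o : psort)
    (R : Z P o -> (forall j : 'I_n, Z P (i j)) -> Prop) (k : 'I_n)
    (hres : residuated_at (image_op_closed R) k) :
  is_residual (image_op_closed R) (beta R k) /\
  (forall (E : forall j : 'I_n, galois P (i j)) (G : galois P o),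
     is_galois (beta R k E G) /\
     is_galois_join (residual_family R k E G) (beta R k E G)).
Proof.
have [g gP] := hres; split=> [E F G|E G].
  by rewrite (beta_residual _ _ gP); apply: gP.
have gal : is_galois (beta R k E G).
  by rewrite (beta_residual _ _ gP); apply: gal_setP.
(* A union is the least upper bound among all subsets, so once it is Galois it is also the join
   among Galois sets. *)
split=> //; split=> // [F SF z Fz|H ub z [F SF Fz]]; first by exists F.
exact: ub SF z Fz.
Qed.
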